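(* Let $N\ge1$, and for each $i\in\mathcal N$ let $K_i\in\mathbb R^{n_u\times n_x}$ be given, with the linear control law $\kappa(x,i)=K_ix$. Suppose that: (a) for all $i\in\mathcal N$, $\ell(\cdot,\cdot,i)$ and $\ell_N(\cdot,i)$ are continuous on their domains, and the sets $U_i(x)=\{u\in\mathbb R^{n_u}:(x,u)\in Y_i\}$ are compact and bounded uniformly in $x$; (b) for each $i\in\mathcal N$, $f(\cdot,\cdot,i)$ is differentiable with $L_i$-Lipschitz Jacobian; (c) for $i\in\mathcal N$, with $m_i>0$, $$\mathcal L'\ell_N(x,i)\le-x^\top(\bar Q_i+m_iI)x,\qquad\text{where}\quad \mathcal L'\ell_N(x,i):=\rho_i\big[\ell_N(\bar A_ix,j);\,j\big]-\ell_N(x,i);$$ (d) $\ell$, $\ell_N$ and $X^f=(X^f_i)_{i\in\mathcal N}$ satisfy the following requirements: there is $c>0$ with $c\|x\|^2\le\ell(x,u,i)$ for all $(x,u)\in Y_i$, $i\in\mathcal N$; there is $d>0$ with $\ell_N(x,i)\le d\|x\|^2$ for all $x\in X^f_i$, $i\in\mathcal N$; each $X^f_i$ contains the origin in its interior; $V_N^\star$ is locally bounded over its domain, that is, for every compact $\bar X\subseteq\operatorname{dom}V_N^\star$ there is $M\ge0$ such that $V_N^\star(x,i)\le M$ for all $(x,i)\in\bar X$; and $\mathbf T\ell_N\le\ell_N$; (e) for all $i\in\mathcal N$, $X^f_i\subseteq\{x:\|x\|\le\delta_i\}$ for some $\delta_i>0$, and $$\sigma_i:=\max_{j\in\operatorname{cov}(i)}\|P^f_j\|\Big(\frac{\beta_i^2\delta_i^2}{4}+\beta_i\|\bar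 A_i\|\delta_i\Big)<m_i,\qquad\text{where }\beta_i:=L_i(1+\|K_i\|^2);$$ (f) $\ell(x,K_ix,i)\le x^\top\big(\bar Q_i+(m_i-\sigma_i)I\big)x$; (g) $X^f$ is uniformly invariant for the system $x_{k+1}=f(x_k,K_{i_k}x_k,i_k)$ subject to $(x_k,K_{i_k}x_k)\in Y_{i_k}$. Let $\kappa_N^\star$ be a control law with $\kappa_N^\star(x,i)\in\mathcal U_N^\star(x,i)$ for all $(x,i)\in\operatorname{dom}V_N^\star$. Then the origin is risk-square exponentially stable (RSES) for the MPC-controlled system $x_{k+1}=f(x_k,\kappa_N^\star(x_k,i_k),i_k)$ over the compact uniformly invariant subsets of $\operatorname{dom}V_N^\star$.
   Context: Let $\mathcal N=\{1,\dots,n\}$ and let $(i_k)_{k\in\mathbb N}$ be a time-homogeneous Markov chain on $\mathcal N$ with transition matrix $P=(p_{ij})$; $P_i$ denotes the $i$-th row of $P$, and $\operatorname{cov}(i)=\{j\in\mathcal N: p_{ij}>0\}$. For a nonempty set $E$, $\operatorname{fcns}(E,\mathcal N)$ is the set of functions $V:E\times\mathcal N\to\mathbb R\cup\{+\infty\}$ with $V(x,i)\ge0$ and $V(0,i)=0$ for all $x\in E$, $i\in\mathcal N$. Domains are sets of points where the function is finite. A collection $(C_i)_{i\in\mathcal N}$ of sets is identified with $\{(x,i):x\in C_i\}$ (it is compact if every $C_i$ is). Norms are Euclidean norms and induced matrix norms. System and costs. For each $i\in\mathcal N$, $f(\cdot,\cdot,i):\mathbb R^{n_x}\times\mathbb R^{n_u}\to\mathbb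 R^{n_x}$ is continuous with $f(0,0,i)=0$, and $Y_i\subseteq\mathbb R^{n_x}\times\mathbb R^{n_u}$ is a nonempty closed set containing the origin. The stage cost is $\ell\in\operatorname{fcns}(\mathbb R^{n_x}\times\mathbb R^{n_u},\mathcal N)$ with $\operatorname{dom}\ell(\cdot,\cdot,i)=Y_i$. The terminal cost is $\ell_N\in\operatorname{fcns}(\mathbb R^{n_x},\mathcal N)$ with $\operatorname{dom}\ell_N(\cdot,i)=X^f_i$, and $P^f_i$ denotes its symmetric positive definite cost matrix: $\ell_N(x,i)=x^\top P^f_ix$ for $x\in X^f_i$ and $\ell_N(x,i)=+\infty$ otherwise. Let $A_i=J_xf(0,0,i)$, $B_i=J_uf(0,0,i)$ be the Jacobians at the origin with respect to $x$ and $u$, $\bar A_i=A_i+B_iK_i$, and $\bar Q_i=Q_i+K_i^\top R_iK_i$, where $Q_i$ is a symmetric positive semidefinite $n_x\times n_x$ matrix and $R_i$ is a symmetric positive definite $n_u\times n_u$ matrix. Risk. A coherent risk measure $\rho$ is given with ambiguity sets $\mathcal A(p)$: for every probability vector $p\in\mathbb R^n$, $\mathcal A(p)\subseteq\mathbb R^n$ is a compact convex set of probability vectors containing $p$. The associated Markov risk measure is $$\rho_i[Z;j]=\max_{\mu\in\mathcal A(P_i)}\sum_{j\in\mathcal N}\mu_jZ(i,j),$$ where the risk is taken with respect to $j$ (for $[0,+\infty]$-valued $Z$: supremum, with $0\cdot\infty=0$). For a random variable $\psi(i_0,\dots,i_k)$, the nested risk measure is $$\bar\rho_k[\psi]=\rho_{i_0}\Big[\rho_{i_1}\big[\cdots\rho_{i_{k-1}}[\psi(i_0,\dots,i_k);i_k]\cdots;i_2\big];i_1\Big],$$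 and $\bar\rho_k$ is the identity for $k\le0$. Dynamic programming. For $V\in\operatorname{fcns}(\mathbb R^{n_x},\mathcal N)$ let $$(\mathbf TV)(x,i)=\inf_{u\in\mathbb R^{n_u}}\Big\{\ell(x,u,i)+\rho_i\big[V(f(x,u,i),j);j\big]\Big\},$$ and let $(\mathbf SV)(x,i)$ be the set of minimizers of this problem. Define $V_0^\star=\ell_N$, $V_{k+1}^\star=\mathbf TV_k^\star$ and $\mathcal U_{k+1}^\star=\mathbf SV_k^\star$ for $k=0,\dots,N-1$. Closed loop. For a control law $\kappa$, set $f^\kappa(x,i)=f(x,\kappa(x,i),i)$ and $X^\kappa_i=\{x:(x,\kappa(x,i))\in Y_i\}$. Outside $\operatorname{dom}V_N^\star$, $\kappa_N^\star$ may be taken arbitrary. With $i_{[k]}=(i_0,\dots,i_k)$ an admissible path of the chain ($i_{t+1}\in\operatorname{cov}(i_t)$), $\phi(k,x_0,i_{[k-1]})$ is the solution at time $k$ of $x_{k+1}=f^\kappa(x_k,i_k)$ starting from $x_0$. Uniform invariance. A collection $X=(X_i)_{i\in\mathcal N}$ of nonempty closed subsets of $\mathbb R^{n_x}$ with $X_i\subseteq X_i^\kappa$ is uniformly invariant for $x_{k+1}=f^\kappa(x_k,i_k)$ if for all $i\in\mathcal N$ and $x\in X_i$ one has $f^\kappa(x,i)\in\bigcap_{j\in\operatorname{cov}(i)}X_j$. RSES. The origin is risk-square exponentially stable for $x_{k+1}=f^\kappa(x_k,i_k)$ over $X=(X_i)_{i\in\mathcal N}$ if $X$ is uniformly invariant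 and there exist $\beta\in[0,1)$ and $\lambda\ge0$ such that for all $i_0\in\mathcal N$, $x_0\in X_{i_0}$ and $k\in\mathbb N$, $$\bar\rho_{k-1}\big[\|\phi(k,x_0,i_{[k-1]})\|^2\big]\le\lambda\beta^k\|x_0\|^2.$$ *)

(* Defs.v *)
From HB Require Import structures.
From mathcomp Require Import all_boot all_order all_algebra.
From mathcomp Require Import all_classical all_reals all_analysis.

Set Implicit Arguments.
Unset Strict Implicit.
Unset Printing Implicit Defensive.

Import Order.TTheory GRing.Theory Num.Theory.
Import numFieldNormedType.Exports.

Local Open Scope classical_set_scope.
Local Open Scope ring_scope.

(* The library norm on matrices is the sup norm, so the Euclidean norm and
   the matrix norm it induces are defined here. *)
Definition enorm (R : realType) (m : nat) (x : 'cV[R]_m) : R :=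
  Num.sqrt (\sum_(k < m) x k 0 ^+ 2).

Definition mxnorm2 (R : realType) (p m : nat) (M : 'M[R]_(p, m)) : R :=
  sup [set enorm (M *m x) | x in [set x : 'cV[R]_m | enorm x <= 1]].

Definition quad (R : realType) (m : nat) (M : 'M[R]_m) (x : 'cV[R]_m) : R :=
  (x^T *m M *m x) 0 0.

Definition sym_psd (R : realType) (m : nat) (M : 'M[R]_m) : Prop :=
  M^T = M /\ forall x : 'cV[R]_m, 0 <= quad M x.

Definition sym_pd (R : realType) (m : nat) (M : 'M[R]_m) : Prop :=
  M^T = M /\ forall x : 'cV[R]_m, x != 0 -> 0 < quad M x.

(* The library's [jacobian] acts on row vectors by right multiplication;
   transposing gives the usual matrix (d g_a / d x_b)_(a, b). *)
Definition Jac (R : realType) (m p : nat) (g : 'cV[R]_m -> 'cV[R]_p)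
    (x : 'cV[R]_m) : 'M[R]_(p, m) :=
  ('J (fun v : 'rV[R]_m => (g v^T)^T) x^T)^T.

Definition Jac_x (R : realType) (nx nu n : nat)
    (f : 'cV[R]_nx -> 'cV[R]_nu -> 'I_n -> 'cV[R]_nx)
    (x : 'cV[R]_nx) (u : 'cV[R]_nu) (i : 'I_n) : 'M[R]_(nx, nx) :=
  Jac (fun y => f y u i) x.

Definition Jac_u (R : realType) (nx nu n : nat)
    (f : 'cV[R]_nx -> 'cV[R]_nu -> 'I_n -> 'cV[R]_nx)
    (x : 'cV[R]_nx) (u : 'cV[R]_nu) (i : 'I_n) : 'M[R]_(nx, nu) :=
  Jac (fun v => f x v i) u.

Definition Jac_xu (R : realType) (nx nu n : nat)
    (f : 'cV[R]_nx -> 'cV[R]_nu -> 'I_n -> 'cV[R]_nx)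
    (x : 'cV[R]_nx) (u : 'cV[R]_nu) (i : 'I_n) : 'M[R]_(nx, nx + nu) :=
  row_mx (Jac_x f x u i) (Jac_u f x u i).

Definition lipschitz_jacobian (R : realType) (nx nu n : nat)
    (f : 'cV[R]_nx -> 'cV[R]_nu -> 'I_n -> 'cV[R]_nx) (i : 'I_n) (L : R)
    : Prop :=
  forall (x x' : 'cV[R]_nx) (u u' : 'cV[R]_nu),
    mxnorm2 (Jac_xu f x u i - Jac_xu f x' u' i)
      <= L * enorm (col_mx (x - x') (u - u')).

Definition prob_vector (R : realType) (n : nat) (p : 'rV[R]_n) : Prop :=
  (forall j, 0 <= p 0 j) /\ \sum_(j < n) p 0 j = 1.

Definition stochastic (R : realType) (n : nat) (P : 'M[R]_n) : Prop :=
  forall i, prob_vector (row i P).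

Definition cov (R : realType) (n : nat) (P : 'M[R]_n) (i : 'I_n)
  : pred 'I_n := fun j => 0 < P i j.

Definition admissible (R : realType) (n : nat) (P : 'M[R]_n)
    (s : seq 'I_n) : bool :=
  sorted (fun i j => j \in cov P i) s.

Definition fcns (R : realType) (n : nat) (E : zmodType)
    (V : E -> 'I_n -> \bar R) : Prop :=
  (forall x i, (0 <= V x i)%E) /\ (forall i, V 0 i = 0%E).

Definition dom (R : realType) (n : nat) (E : Type)
    (V : E -> 'I_n -> \bar R) (i : 'I_n) : set E :=
  [set x | V x i \is a fin_num].

Definition ambiguity_sets (R : realType) (n : nat)
    (A : 'rV[R]_n -> set 'rV[R]_n) : Prop :=
  forall p, prob_vector p ->
    [/\ compact (A p),
        convex_set (A p : set (convex_lmodType 'rV[R]_n)),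
        A p `<=` prob_vector (n := n)
      & A p p].

Definition markov_risk (R : realType) (n : nat)
    (A : 'rV[R]_n -> set 'rV[R]_n) (P : 'M[R]_n)
    (i : 'I_n) (Z : 'I_n -> \bar R) : \bar R :=
  ereal_sup [set (\sum_(j < n) (mu 0 j)%:E * Z j)%E | mu in A (row i P)].

(* [nested_risk rho k psi s i] treats the last k indices of a path as random:
   s is the path before the current mode i. *)
Fixpoint nested_risk (R : realType) (n : nat)
    (rho : 'I_n -> ('I_n -> \bar R) -> \bar R) (k : nat)
    (psi : seq 'I_n -> \bar R) (s : seq 'I_n) (i : 'I_n) : \bar R :=
  match k with
  | 0%N => psi (rcons s i)
  | k'.+1 => rho i (fun j => nested_risk rho k' psi (rcons s i) j)
  end.

(* psi takes the path [:: i_0; ...; i_k]; the result depends on i_0. *)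
Definition nested_markov_risk (R : realType) (n : nat)
    (A : 'rV[R]_n -> set 'rV[R]_n) (P : 'M[R]_n) (k : nat)
    (psi : seq 'I_n -> \bar R) (i0 : 'I_n) : \bar R :=
  nested_risk (markov_risk A P) k psi [::] i0.

Definition bellman_obj (R : realType) (nx nu n : nat)
    (f : 'cV[R]_nx -> 'cV[R]_nu -> 'I_n -> 'cV[R]_nx)
    (l : 'cV[R]_nx * 'cV[R]_nu -> 'I_n -> \bar R)
    (A : 'rV[R]_n -> set 'rV[R]_n) (P : 'M[R]_n)
    (V : 'cV[R]_nx -> 'I_n -> \bar R)
    (x : 'cV[R]_nx) (i : 'I_n) (u : 'cV[R]_nu) : \bar R :=
  (l (x, u) i + markov_risk A P i (fun j => V (f x u i) j))%E.

Definition bellman (R : realType) (nx nu n : nat)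
    (f : 'cV[R]_nx -> 'cV[R]_nu -> 'I_n -> 'cV[R]_nx)
    (l : 'cV[R]_nx * 'cV[R]_nu -> 'I_n -> \bar R)
    (A : 'rV[R]_n -> set 'rV[R]_n) (P : 'M[R]_n)
    (V : 'cV[R]_nx -> 'I_n -> \bar R)
    (x : 'cV[R]_nx) (i : 'I_n) : \bar R :=
  ereal_inf (range (bellman_obj f l A P V x i)).

Definition bellman_argmin (R : realType) (nx nu n : nat)
    (f : 'cV[R]_nx -> 'cV[R]_nu -> 'I_n -> 'cV[R]_nx)
    (l : 'cV[R]_nx * 'cV[R]_nu -> 'I_n -> \bar R)
    (A : 'rV[R]_n -> set 'rV[R]_n) (P : 'M[R]_n)
    (V : 'cV[R]_nx -> 'I_n -> \bar R)
    (x : 'cV[R]_nx) (i : 'I_n) : set 'cV[R]_nu :=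
  [set u | forall v,
     (bellman_obj f l A P V x i u <= bellman_obj f l A P V x i v)%E].

Definition Vstar (R : realType) (nx nu n : nat)
    (f : 'cV[R]_nx -> 'cV[R]_nu -> 'I_n -> 'cV[R]_nx)
    (l : 'cV[R]_nx * 'cV[R]_nu -> 'I_n -> \bar R)
    (lN : 'cV[R]_nx -> 'I_n -> \bar R)
    (A : 'rV[R]_n -> set 'rV[R]_n) (P : 'M[R]_n) (k : nat)
    : 'cV[R]_nx -> 'I_n -> \bar R :=
  iter k (bellman f l A P) lN.

(* Only meaningful for k >= 1. *)
Definition Ustar (R : realType) (nx nu n : nat)
    (f : 'cV[R]_nx -> 'cV[R]_nu -> 'I_n -> 'cV[R]_nx)
    (l : 'cV[R]_nx * 'cV[R]_nu -> 'I_n -> \bar R)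
    (lN : 'cV[R]_nx -> 'I_n -> \bar R)
    (A : 'rV[R]_n -> set 'rV[R]_n) (P : 'M[R]_n) (k : nat)
    : 'cV[R]_nx -> 'I_n -> set 'cV[R]_nu :=
  bellman_argmin f l A P (Vstar f l lN A P k.-1).

Definition locally_bounded_on_dom (R : realType) (nx n : nat)
    (V : 'cV[R]_nx -> 'I_n -> \bar R) : Prop :=
  forall X : 'I_n -> set 'cV[R]_nx,
    (forall i, compact (X i)) -> (forall i, X i `<=` dom V i) ->
    exists2 M : R, 0 <= M & forall i x, X i x -> (V x i <= M%:E)%E.

Definition closed_loop (R : realType) (nx nu n : nat)
    (f : 'cV[R]_nx -> 'cV[R]_nu -> 'I_n -> 'cV[R]_nx)
    (kappa : 'cV[R]_nx -> 'I_n -> 'cV[R]_nu)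
    (x : 'cV[R]_nx) (i : 'I_n) : 'cV[R]_nx :=
  f x (kappa x i) i.

Definition feasible (R : realType) (nx nu n : nat)
    (Y : 'I_n -> set ('cV[R]_nx * 'cV[R]_nu))
    (kappa : 'cV[R]_nx -> 'I_n -> 'cV[R]_nu) (i : 'I_n) : set 'cV[R]_nx :=
  [set x | Y i (x, kappa x i)].

Definition uniformly_invariant (R : realType) (nx nu n : nat)
    (f : 'cV[R]_nx -> 'cV[R]_nu -> 'I_n -> 'cV[R]_nx)
    (Y : 'I_n -> set ('cV[R]_nx * 'cV[R]_nu)) (P : 'M[R]_n)
    (kappa : 'cV[R]_nx -> 'I_n -> 'cV[R]_nu)
    (X : 'I_n -> set 'cV[R]_nx) : Prop :=
  (forall i, [/\ X i !=set0, closed (X i) & X i `<=` feasible Y kappa i]) /\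
  (forall i x, X i x ->
     forall j, j \in cov P i -> X j (closed_loop f kappa x i)).

(* State at time k along the path s = [:: i_0; i_1; ...]; only the modes
   i_0, ..., i_(k-1) matter. *)
Definition solution (R : realType) (nx nu n : nat)
    (f : 'cV[R]_nx -> 'cV[R]_nu -> 'I_n -> 'cV[R]_nx)
    (kappa : 'cV[R]_nx -> 'I_n -> 'cV[R]_nu)
    (k : nat) (x0 : 'cV[R]_nx) (s : seq 'I_n) : 'cV[R]_nx :=
  foldl (closed_loop f kappa) x0 (take k s).

(* The solution is a random variable on the admissible paths of the chain.
   An ambiguity set may put mass on modes outside the cover; the squared norm
   is extended by 0 to inadmissible paths, on which no solution is defined. *)
Definition sqnorm_solution (R : realType) (nx nu n : nat)
    (f : 'cV[R]_nx -> 'cV[R]_nu -> 'I_n -> 'cV[R]_nx) (P : 'M[R]_n)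
    (kappa : 'cV[R]_nx -> 'I_n -> 'cV[R]_nu)
    (k : nat) (x0 : 'cV[R]_nx) (s : seq 'I_n) : \bar R :=
  if admissible P s then (enorm (solution f kappa k x0 s) ^+ 2)%:E else 0%E.

(* k.-1 is 0 for k = 0: the nested risk is then the identity, as for k = 1. *)
Definition RSES (R : realType) (nx nu n : nat)
    (f : 'cV[R]_nx -> 'cV[R]_nu -> 'I_n -> 'cV[R]_nx)
    (Y : 'I_n -> set ('cV[R]_nx * 'cV[R]_nu))
    (A : 'rV[R]_n -> set 'rV[R]_n) (P : 'M[R]_n)
    (kappa : 'cV[R]_nx -> 'I_n -> 'cV[R]_nu)
    (X : 'I_n -> set 'cV[R]_nx) : Prop :=
  uniformly_invariant f Y P kappa X /\
  exists beta lambda : R,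
    [/\ 0 <= beta, beta < 1, 0 <= lambda &
      forall i0 x0 (k : nat), X i0 x0 ->
        (nested_markov_risk A P k.-1 (sqnorm_solution f P kappa k x0) i0
          <= (lambda * beta ^+ k * enorm x0 ^+ 2)%:E)%E].

Definition Abar (R : realType) (nx nu n : nat)
    (f : 'cV[R]_nx -> 'cV[R]_nu -> 'I_n -> 'cV[R]_nx)
    (K : 'I_n -> 'M[R]_(nu, nx)) (i : 'I_n) : 'M[R]_nx :=
  Jac_x f 0 0 i + Jac_u f 0 0 i *m K i.

Definition Qbar (R : realType) (nx nu n : nat)
    (Qc : 'I_n -> 'M[R]_nx) (Rc : 'I_n -> 'M[R]_nu)
    (K : 'I_n -> 'M[R]_(nu, nx)) (i : 'I_n) : 'M[R]_nx :=
  Qc i + (K i)^T *m Rc i *m K i.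

Definition beta_lin (R : realType) (nx nu n : nat) (L : 'I_n -> R)
    (K : 'I_n -> 'M[R]_(nu, nx)) (i : 'I_n) : R :=
  L i * (1 + mxnorm2 (K i) ^+ 2).

Definition sigma_lin (R : realType) (nx nu n : nat)
    (f : 'cV[R]_nx -> 'cV[R]_nu -> 'I_n -> 'cV[R]_nx) (P : 'M[R]_n)
    (Pf : 'I_n -> 'M[R]_nx) (L delta : 'I_n -> R)
    (K : 'I_n -> 'M[R]_(nu, nx)) (i : 'I_n) : R :=
  (\big[Num.max/0]_(j in cov P i) mxnorm2 (Pf j)) *
  (beta_lin L K i ^+ 2 * delta i ^+ 2 / 4
   + beta_lin L K i * mxnorm2 (Abar f K i) * delta i).

(* L' lN; used only for x in the domain of lN, where the difference is
   well defined. *)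
Definition Lprime (R : realType) (nx nu n : nat)
    (f : 'cV[R]_nx -> 'cV[R]_nu -> 'I_n -> 'cV[R]_nx)
    (A : 'rV[R]_n -> set 'rV[R]_n) (P : 'M[R]_n)
    (K : 'I_n -> 'M[R]_(nu, nx))
    (lN : 'cV[R]_nx -> 'I_n -> \bar R) (x : 'cV[R]_nx) (i : 'I_n) : \bar R :=
  (markov_risk A P i (fun j => lN (Abar f K i *m x) j) - lN x i)%E.

(* Main.v *)
Require Import Defs.
From HB Require Import structures.
From mathcomp Require Import all_boot all_order all_algebra.
From mathcomp Require Import all_classical all_reals all_analysis.

Set Implicit Arguments.
Unset Strict Implicit.
Unset Printing Implicit Defensive.

Import Order.TTheory GRing.Theory Num.Theory.
Import numFieldNormedType.Exports.

Local Open Scope classical_set_scope.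
Local Open Scope ring_scope.

(* Since T lN <= lN and T is monotone, V := V_N satisfies V_N <= V_(N-1), so
   the Bellman equation at the minimizer gives the Lyapunov inequality
   l(x, kappa x, i) + rho_i [V (x^+, j)] <= V (x, i).  Here V >= c |x|^2
   everywhere, and V <= D |x|^2 on a compact set X: near the origin from
   V <= lN, elsewhere from local boundedness.  Hence
   rho_i [V (x^+, j)] <= (1 - c / D) V (x, i) on X, and iterating this along
   the nested risk gives the exponential bound. *)

(** * Order and scaling properties of the Markov risk measure *)

Lemma markov_risk_le (R : realType) (n : nat) (A : 'rV[R]_n -> set 'rV[R]_n)
    (P : 'M[R]_n) (hA : ambiguity_sets A) (hP : stochastic P) (i : 'I_n)
    (Z1 Z2 : 'I_n -> \bar R) :
  (forall j, Z1 j <= Z2 j)%E -> (markov_risk A P i Z1 <= markov_risk A P i Z2)%E.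
Proof.
move=> Z12; have [_ _ Aprob _] := hA _ (hP i).
apply: ge_ereal_sup => _ [mu Amu <-]; have [mu0 _] := Aprob _ Amu.
apply: le_trans (ereal_sup_ubound _); last by exists mu.
by apply: lee_sum => j _; apply: lee_wpmul2l; rewrite ?lee_fin.
Qed.

(** The ambiguity set contains [row i P] itself, so the supremum, which would be [-oo] on an empty
    set, dominates a nonnegative expectation. *)
Lemma markov_risk_ge0 (R : realType) (n : nat) (A : 'rV[R]_n -> set 'rV[R]_n)
    (P : 'M[R]_n) (hA : ambiguity_sets A) (hP : stochastic P) (i : 'I_n)
    (Z : 'I_n -> \bar R) :
  (forall j, 0 <= Z j)%E -> (0 <= markov_risk A P i Z)%E.
Proof.
move=> Z0; have [_ _ Aprob AP] := hA _ (hP i); have [p0 _] := hP i.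
apply: le_trans (ereal_sup_ubound _); last by exists (row i P).
by apply: sume_ge0 => j _; rewrite mule_ge0 ?lee_fin.
Qed.

Lemma markov_risk_cst (R : realType) (n : nat) (A : 'rV[R]_n -> set 'rV[R]_n)
    (P : 'M[R]_n) (hA : ambiguity_sets A) (hP : stochastic P) (i : 'I_n)
    (a : R) :
  markov_risk A P i (fun=> a%:E) = a%:E.
Proof.
have [_ _ Aprob AP] := hA _ (hP i).
rewrite /markov_risk -[RHS]ereal_sup1; congr ereal_sup.
have sum_mu mu : A (row i P) mu -> (\sum_(j < n) (mu 0%R j)%:E * a%:E)%E = a%:E.
  move=> /Aprob[_ mu1].
  under eq_bigr do rewrite -EFinM.
  by rewrite sumEFin -mulr_suml mu1 mul1r.
apply/seteqP; split=> [_ [mu Amu <-]|_ ->]; first exact: sum_mu.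
by exists (row i P) => //; exact: sum_mu.
Qed.

Lemma markov_risk_scale (R : realType) (n : nat)
    (A : 'rV[R]_n -> set 'rV[R]_n) (P : 'M[R]_n) (hA : ambiguity_sets A)
    (hP : stochastic P) (i : 'I_n) (a : R) (Z : 'I_n -> \bar R) :
  0 <= a -> (forall j, 0 <= Z j)%E ->
  (markov_risk A P i (fun j => a%:E * Z j) <= a%:E * markov_risk A P i Z)%E.
Proof.
move=> a0 Z0; have [_ _ Aprob _] := hA _ (hP i).
apply: ge_ereal_sup => _ [mu Amu <-]; have [mu0 _] := Aprob _ Amu.
rewrite (eq_bigr (fun j => a%:E * ((mu 0%R j)%:E * Z j))%E); last first.
  by move=> j _; rewrite muleCA.
rewrite -ge0_sume_distrr; last by move=> j _; rewrite mule_ge0 ?lee_fin.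
apply: lee_wpmul2l; rewrite ?lee_fin //.
by apply: ereal_sup_ubound; exists mu.
Qed.

(** * Value functions of the dynamic program *)

Lemma bellman_le (R : realType) (nx nu n : nat)
    (f : 'cV[R]_nx -> 'cV[R]_nu -> 'I_n -> 'cV[R]_nx)
    (l : 'cV[R]_nx * 'cV[R]_nu -> 'I_n -> \bar R)
    (A : 'rV[R]_n -> set 'rV[R]_n) (P : 'M[R]_n)
    (hA : ambiguity_sets A) (hP : stochastic P)
    (V1 V2 : 'cV[R]_nx -> 'I_n -> \bar R) :
  (forall x i, V1 x i <= V2 x i)%E ->
  forall x i, (bellman f l A P V1 x i <= bellman f l A P V2 x i)%E.
Proof.
move=> V12 x i; apply: le_ereal_inf_tmp => _ [u _ <-].
apply: le_trans (ereal_inf_lbound _) _; first by exists u.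
by apply: leeD2l; exact: markov_risk_le.
Qed.

Lemma Vstar_nonincreasing (R : realType) (nx nu n : nat)
    (f : 'cV[R]_nx -> 'cV[R]_nu -> 'I_n -> 'cV[R]_nx)
    (l : 'cV[R]_nx * 'cV[R]_nu -> 'I_n -> \bar R)
    (lN : 'cV[R]_nx -> 'I_n -> \bar R)
    (A : 'rV[R]_n -> set 'rV[R]_n) (P : 'M[R]_n)
    (hA : ambiguity_sets A) (hP : stochastic P)
    (hT : forall x i, (bellman f l A P lN x i <= lN x i)%E) (k : nat) x i :
  (Vstar f l lN A P k.+1 x i <= Vstar f l lN A P k x i)%E.
Proof. by elim: k x i => [//|k IH] x i; exact: bellman_le. Qed.

Lemma Vstar_le_terminal (R : realType) (nx nu n : nat)
    (f : 'cV[R]_nx -> 'cV[R]_nu -> 'I_n -> 'cV[R]_nx)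
    (l : 'cV[R]_nx * 'cV[R]_nu -> 'I_n -> \bar R)
    (lN : 'cV[R]_nx -> 'I_n -> \bar R)
    (A : 'rV[R]_n -> set 'rV[R]_n) (P : 'M[R]_n)
    (hA : ambiguity_sets A) (hP : stochastic P)
    (hT : forall x i, (bellman f l A P lN x i <= lN x i)%E) (k : nat) x i :
  (Vstar f l lN A P k x i <= lN x i)%E.
Proof.
by elim: k => [//|k IH]; apply: le_trans IH; exact: Vstar_nonincreasing.
Qed.

Lemma Vstar_ge0 (R : realType) (nx nu n : nat)
    (f : 'cV[R]_nx -> 'cV[R]_nu -> 'I_n -> 'cV[R]_nx)
    (l : 'cV[R]_nx * 'cV[R]_nu -> 'I_n -> \bar R)
    (lN : 'cV[R]_nx -> 'I_n -> \bar R)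
    (A : 'rV[R]_n -> set 'rV[R]_n) (P : 'M[R]_n)
    (hA : ambiguity_sets A) (hP : stochastic P)
    (l0 : forall z i, (0 <= l z i)%E) (lN0 : forall x i, (0 <= lN x i)%E)
    (k : nat) x i :
  (0 <= Vstar f l lN A P k x i)%E.
Proof.
elim: k x i => [//|k IH] x i; apply: le_ereal_inf_tmp => _ [u _ <-].
by rewrite adde_ge0 //; exact: markov_risk_ge0.
Qed.

(** A lower bound [g] independent of [u] survives the infimum over inputs, and the risk term only
    adds a nonnegative amount. *)
Lemma Vstar_ge_stage (R : realType) (nx nu n : nat)
    (f : 'cV[R]_nx -> 'cV[R]_nu -> 'I_n -> 'cV[R]_nx)
    (l : 'cV[R]_nx * 'cV[R]_nu -> 'I_n -> \bar R)
    (lN : 'cV[R]_nx -> 'I_n -> \bar R)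
    (A : 'rV[R]_n -> set 'rV[R]_n) (P : 'M[R]_n)
    (hA : ambiguity_sets A) (hP : stochastic P)
    (l0 : forall z i, (0 <= l z i)%E) (lN0 : forall x i, (0 <= lN x i)%E)
    (g : 'cV[R]_nx -> \bar R) (hg : forall x u i, (g x <= l (x, u) i)%E)
    (k : nat) x i :
  (g x <= Vstar f l lN A P k.+1 x i)%E.
Proof.
apply: le_ereal_inf_tmp => _ [u _ <-].
apply: le_trans (hg x u i) _; rewrite leeDl //.
by apply: markov_risk_ge0 => // j; exact: Vstar_ge0.
Qed.

Lemma Vstar_lyapunov (R : realType) (nx nu n : nat)
    (f : 'cV[R]_nx -> 'cV[R]_nu -> 'I_n -> 'cV[R]_nx)
    (l : 'cV[R]_nx * 'cV[R]_nu -> 'I_n -> \bar R)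
    (lN : 'cV[R]_nx -> 'I_n -> \bar R)
    (A : 'rV[R]_n -> set 'rV[R]_n) (P : 'M[R]_n)
    (hA : ambiguity_sets A) (hP : stochastic P)
    (hT : forall x i, (bellman f l A P lN x i <= lN x i)%E) (k : nat) x i u :
  Ustar f l lN A P k.+1 x i u ->
  (l (x, u) i + markov_risk A P i (fun j => Vstar f l lN A P k.+1 (f x u i) j)
    <= Vstar f l lN A P k.+1 x i)%E.
Proof.
(* Optimality of [u] compares objectives with [V_k] under the risk; putting the smaller [V_(k+1)]
   there on the left only strengthens the comparison. *)
move=> Uu; apply: le_ereal_inf_tmp => _ [v _ <-]; apply: le_trans (Uu v).
by apply: leeD2l; apply: markov_risk_le => // j; exact: Vstar_nonincreasing.
Qed.

(** * Euclidean balls and the quadratic upper bound *)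

Lemma coord_le_enorm (R : realType) (m : nat) (x : 'cV[R]_m) (k : 'I_m) :
  `|x k 0| <= enorm x.
Proof.
rewrite -sqrtr_sqr ler_wsqrtr // (bigD1 k) //= lerDl.
by apply: sumr_ge0 => j _; exact: sqr_ge0.
Qed.

(** Neighbourhoods are given by sup-norm balls, and each of these contains the Euclidean ball of the
    same radius. *)
Lemma nbhs0_enorm (R : realType) (m : nat) (B : set 'cV[R]_m) :
  nbhs (0 : 'cV[R]_m) B -> exists2 r : R, 0 < r & forall x, enorm x < r -> B x.
Proof.
move=> /nbhs_ballP[r r0 rB]; exists r => // x xr; apply: rB; split=> // a b.
rewrite ord1 -ball_normE /= mxE sub0r normrN.
exact: le_lt_trans (coord_le_enorm x a) xr.
Qed.

Lemma quadratic_upper_bound (R : realType) (nx n : nat)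
    (V lN : 'cV[R]_nx -> 'I_n -> \bar R) (Xf X : 'I_n -> set 'cV[R]_nx)
    (d M : R) :
  (forall x i, V x i <= lN x i)%E ->
  (forall i, nbhs (0 : 'cV[R]_nx) (Xf i)) ->
  (forall i x, Xf i x -> (lN x i <= (d * enorm x ^+ 2)%:E)%E) ->
  0 <= M -> (forall i x, X i x -> (V x i <= M%:E)%E) ->
  exists D : R, forall i x, X i x -> (V x i <= (D * enorm x ^+ 2)%:E)%E.
Proof.
move=> VlN Xf0 lNd M0 VM.
(* There are finitely many modes, so one radius serves them all. *)
have /nbhs0_enorm[r r0 rXf] : nbhs (0 : 'cV[R]_nx) [set x | forall i, Xf i x].
  exact: filter_forall Xf0.
(* Inside the ball of radius [r] the terminal cost gives [d]; outside it,
   [M <= M / r ^+ 2 * enorm x ^+ 2]. *)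
exists (Num.max d (M / r ^+ 2)) => i x Xx.
have [/rXf/(_ i)/lNd xr|rx] := ltP (enorm x) r.
  apply: le_trans (VlN x i) _; apply: le_trans xr _.
  by rewrite lee_fin ler_wpM2r ?sqr_ge0 // le_max lexx.
apply: le_trans (VM _ _ Xx) _; rewrite lee_fin.
apply: (@le_trans _ _ (M / r ^+ 2 * enorm x ^+ 2)); last first.
  by rewrite ler_wpM2r ?sqr_ge0 // le_max lexx orbT.
rewrite mulrAC ler_pdivlMr ?exprn_gt0 // ler_wpM2l //.
by rewrite lerXn2r // nnegrE ltW // (lt_le_trans r0).
Qed.

(** * Nested risk along paths of modes *)

Lemma sqnorm_solution_rcons (R : realType) (nx nu n : nat)
    (f : 'cV[R]_nx -> 'cV[R]_nu -> 'I_n -> 'cV[R]_nx) (P : 'M[R]_n)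
    (kappa : 'cV[R]_nx -> 'I_n -> 'cV[R]_nu) (x0 : 'cV[R]_nx)
    (s : seq 'I_n) (i : 'I_n) :
  admissible P (rcons s i) ->
  sqnorm_solution f P kappa (size s).+1 x0 (rcons s i) =
  (enorm (closed_loop f kappa (foldl (closed_loop f kappa) x0 s) i) ^+ 2)%:E.
Proof.
move=> adm; rewrite /sqnorm_solution adm /solution.
by rewrite take_oversize ?size_rcons // foldl_rcons.
Qed.

Lemma admissible_rcons2 (R : realType) (n : nat) (P : 'M[R]_n)
    (s : seq 'I_n) (i j : 'I_n) :
  admissible P (rcons (rcons s i) j) =
  admissible P (rcons s i) && (j \in cov P i).
Proof.
case: s => [|a s]; rewrite /admissible /=; first by rewrite andbT.
by rewrite rcons_path last_rcons.
Qed.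

(** Every extension of an inadmissible path is inadmissible, so all final values are 0, and the risk
    of the constant 0 is 0. *)
Lemma nested_risk_inadmissible (R : realType) (nx nu n : nat)
    (f : 'cV[R]_nx -> 'cV[R]_nu -> 'I_n -> 'cV[R]_nx)
    (A : 'rV[R]_n -> set 'rV[R]_n) (P : 'M[R]_n)
    (hA : ambiguity_sets A) (hP : stochastic P)
    (kappa : 'cV[R]_nx -> 'I_n -> 'cV[R]_nu) (T : nat) (x0 : 'cV[R]_nx)
    (k : nat) (s : seq 'I_n) (i : 'I_n) :
  ~~ admissible P (rcons s i) ->
  nested_risk (markov_risk A P) k (sqnorm_solution f P kappa T x0) s i = 0%E.
Proof.
elim: k s i => [|k IH] s i adm /=.
  by rewrite /sqnorm_solution (negbTE adm).
rewrite -[RHS](markov_risk_cst hA hP i); congr markov_risk.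
by apply/funext => j; rewrite IH // admissible_rcons2 negb_and adm.
Qed.

(** Induction on the number [k] of modes still random, for an arbitrary prefix [s]. Each risk
    evaluation contributes a factor [b], and the last passage from squared norm to [V] contributes
    one more, hence the exponent [k.+1]. *)
Lemma nested_risk_decay (R : realType) (nx nu n : nat)
    (f : 'cV[R]_nx -> 'cV[R]_nu -> 'I_n -> 'cV[R]_nx)
    (A : 'rV[R]_n -> set 'rV[R]_n) (P : 'M[R]_n)
    (hA : ambiguity_sets A) (hP : stochastic P)
    (kappa : 'cV[R]_nx -> 'I_n -> 'cV[R]_nu)
    (X : 'I_n -> set 'cV[R]_nx) (V : 'cV[R]_nx -> 'I_n -> \bar R) (b c : R)
    (b0 : 0 <= b) (c0 : 0 < c)
    (Xinv : forall i x, X i x ->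
       forall j, j \in cov P i -> X j (closed_loop f kappa x i))
    (V_ge : forall x i, ((c * enorm x ^+ 2)%:E <= V x i)%E)
    (V_decr : forall i x, X i x ->
       (markov_risk A P i (fun j => V (closed_loop f kappa x i) j)
         <= b%:E * V x i)%E)
    (x0 : 'cV[R]_nx) (k : nat) (s : seq 'I_n) (i : 'I_n) :
  admissible P (rcons s i) -> X i (foldl (closed_loop f kappa) x0 s) ->
  (nested_risk (markov_risk A P) k
     (sqnorm_solution f P kappa (size s + k).+1 x0) s i
   <= (b ^+ k.+1 / c)%:E * V (foldl (closed_loop f kappa) x0 s) i)%E.
Proof.
have V0 x j : (0 <= V x j)%E.
  by apply: le_trans (V_ge x j); rewrite lee_fin mulr_ge0 ?sqr_ge0 // ltW.
elim: k s i => [|k IH] s i adm; set x := foldl _ _ s => Xx.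
  rewrite addn0 /= sqnorm_solution_rcons // -/x.
  rewrite expr1 (mulrC b) (EFinM c^-1) -muleA.
  rewrite -lee_pdivrMl ?invr_gt0 // invrK -EFinM.
  (* The successor state does not depend on the next mode, so its squared norm times [c] equals its
     own risk and lies below the risk of [V]. *)
  apply: le_trans (V_decr _ _ Xx).
  by rewrite -(markov_risk_cst hA hP i); exact: markov_risk_le.
have ck : 0 <= b ^+ k.+1 / c by rewrite divr_ge0 ?exprn_ge0 // ltW.
(* The horizon stays fixed while [i] moves into the prefix, which matches the induction hypothesis
   for [rcons s i]. *)
rewrite /= -addSnnS -(size_rcons s i).
apply: (@le_trans _ _ (markov_risk A P i
    (fun j => (b ^+ k.+1 / c)%:E * V (closed_loop f kappa x i) j))%E).
  apply: markov_risk_le => // j.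
  (* Invariance reaches only modes in [cov P i]. Elsewhere the ambiguity set may still have mass,
     but the nested risk vanishes there and [V] is nonnegative. *)
  have [adm'|nadm] := boolP (admissible P (rcons (rcons s i) j)); last first.
    by rewrite nested_risk_inadmissible // mule_ge0 ?lee_fin.
  have -> : closed_loop f kappa x i = foldl (closed_loop f kappa) x0 (rcons s i).
    by rewrite foldl_rcons.
  apply: IH => //; rewrite foldl_rcons; apply: Xinv => //.
  by move: adm'; rewrite admissible_rcons2 => /andP[].
apply: le_trans (markov_risk_scale hA hP i ck _) _ => //.
rewrite (exprSr b k.+1) mulrAC (EFinM (_ / c)) -muleA.
by apply: lee_wpmul2l; rewrite ?lee_fin //; exact: V_decr.
Qed.

(** * From the Lyapunov inequality to RSES *)

Lemma lyapunov_RSES (R : realType) (nx nu n : nat)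
    (f : 'cV[R]_nx -> 'cV[R]_nu -> 'I_n -> 'cV[R]_nx)
    (Y : 'I_n -> set ('cV[R]_nx * 'cV[R]_nu))
    (A : 'rV[R]_n -> set 'rV[R]_n) (P : 'M[R]_n)
    (hA : ambiguity_sets A) (hP : stochastic P)
    (kappa : 'cV[R]_nx -> 'I_n -> 'cV[R]_nu)
    (X : 'I_n -> set 'cV[R]_nx) (V : 'cV[R]_nx -> 'I_n -> \bar R) (c D : R)
    (c0 : 0 < c) (Xinv : uniformly_invariant f Y P kappa X)
    (V_ge : forall x i, ((c * enorm x ^+ 2)%:E <= V x i)%E)
    (V_le : forall i x, X i x -> (V x i <= (D * enorm x ^+ 2)%:E)%E)
    (V_decr : forall i x, X i x ->
       ((c * enorm x ^+ 2)%:E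
          + markov_risk A P i (fun j => V (closed_loop f kappa x i) j)
         <= V x i)%E) :
  RSES f Y A P kappa X.
Proof.
split=> //.
have V0 x i : (0 <= V x i)%E.
  by apply: le_trans (V_ge x i); rewrite lee_fin mulr_ge0 ?sqr_ge0 // ltW.
(* Enlarging [D] to at least [c] makes it positive and puts [1 - c / D'] in [0, 1). *)
pose D' := Num.max c D.
have D'0 : 0 < D' by rewrite lt_max c0.
have V_le' i x : X i x -> (V x i <= (D' * enorm x ^+ 2)%:E)%E.
  move=> /V_le/le_trans; apply.
  by rewrite lee_fin ler_wpM2r ?sqr_ge0 // le_max lexx orbT.
pose b := 1 - c / D'.
have b0 : 0 <= b by rewrite subr_ge0 ler_pdivrMr // mul1r le_max lexx.
have b1 : b < 1 by rewrite gtrBl divr_gt0.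
have V_contr i x : X i x ->
    (markov_risk A P i (fun j => V (closed_loop f kappa x i) j)
      <= b%:E * V x i)%E.
  move=> Xx; have := V_decr i x Xx; have := V_le' i x Xx; have := V0 x i.
  (* The two bounds on [V] rule out infinite values; then [c * enorm x ^+ 2 >= c / D' * v] turns the
     decrease into a contraction. *)
  case: (V x i) => [v|//|//]; rewrite !lee_fin => v0 vD.
  rewrite -leeBrDl // => /le_trans; apply.
  rewrite -EFinB -EFinM lee_fin mulrBl mul1r lerB //.
  by rewrite mulrAC ler_pdivrMr // -mulrA ler_pM2l // mulrC.
(* [1 / c] comes from the decay estimate and [D'] from bounding [V] at [x0]; the ratio is at least
   1, which settles time 0. *)
exists b, (D' / c); split=> //; first by rewrite divr_ge0 // ltW.
move=> i0 x0 [|k] Xx0 /=.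
  rewrite /nested_markov_risk /= /sqnorm_solution /= lee_fin expr0 mulr1.
  by rewrite ler_peMl ?sqr_ge0 // ler_pdivlMr // mul1r le_max lexx.
have := @nested_risk_decay _ _ _ _ f A P hA hP kappa X V b c b0 c0 Xinv.2 V_ge
  V_contr x0 k [::] i0 isT Xx0.
move=> /le_trans; apply; rewrite /=.
apply: (@le_trans _ _ ((b ^+ k.+1 / c)%:E * (D' * enorm x0 ^+ 2)%:E)%E).
  by apply: lee_wpmul2l; [rewrite lee_fin divr_ge0 ?exprn_ge0 // ltW|exact: V_le'].
by rewrite -EFinM lee_fin mulrA ler_wpM2r ?sqr_ge0 // mulrC mulrA mulrAC.
Qed.

Theorem theorem2 (R : realType) (n nx nu : nat)
  (P : 'M[R]_n) (A : 'rV[R]_n -> set 'rV[R]_n)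
  (f : 'cV[R]_nx -> 'cV[R]_nu -> 'I_n -> 'cV[R]_nx)
  (Y : 'I_n -> set ('cV[R]_nx * 'cV[R]_nu))
  (l : 'cV[R]_nx * 'cV[R]_nu -> 'I_n -> \bar R)
  (lN : 'cV[R]_nx -> 'I_n -> \bar R)
  (Xf : 'I_n -> set 'cV[R]_nx) (Pf : 'I_n -> 'M[R]_nx)
  (Qc : 'I_n -> 'M[R]_nx) (Rc : 'I_n -> 'M[R]_nu)
  (K : 'I_n -> 'M[R]_(nu, nx)) (L m delta : 'I_n -> R)
  (N : nat) (kappaN : 'cV[R]_nx -> 'I_n -> 'cV[R]_nu)
  (* standing assumptions *)
  (hP : stochastic P)
  (hA : ambiguity_sets A)
  (hf : forall i,
     continuous (fun z : 'cV[R]_nx * 'cV[R]_nu => f z.1 z.2 i))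
  (hf0 : forall i, f 0 0 i = 0)
  (hY : forall i, closed (Y i) /\ Y i (0, 0))
  (hl : fcns l) (hldom : forall i, dom l i = Y i)
  (hlN : fcns lN) (hlNdom : forall i, dom lN i = Xf i)
  (hlNin : forall i x, Xf i x -> lN x i = (quad (Pf i) x)%:E)
  (hlNout : forall i x, ~ Xf i x -> lN x i = +oo%E)
  (hPf : forall i, sym_pd (Pf i))
  (hQ : forall i, sym_psd (Qc i)) (hR : forall i, sym_pd (Rc i))
  (hN : (1 <= N)%N)
  (* (a) *)
  (ha_l : forall i, {within Y i, continuous (fun z => l z i)})
  (ha_lN : forall i, {within Xf i, continuous (fun x => lN x i)})
  (ha_U : forall i,
     (forall x, compact [set u | Y i (x, u)]) /\
     exists b : R, forall x u, Y i (x, u) -> enorm u <= b)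
  (* (b) *)
  (hb_diff : forall i x u,
     differentiable (fun z : 'cV[R]_nx * 'cV[R]_nu => f z.1 z.2 i) (x, u))
  (hb_lip : forall i, lipschitz_jacobian f i (L i))
  (* (c) *)
  (hc_m : forall i, 0 < m i)
  (hc : forall i x, Xf i x ->
     (Lprime f A P K lN x i
       <= (- quad (Qbar Qc Rc K i + (m i)%:M) x)%:E)%E)
  (* (d) *)
  (hd_l : exists2 c : R, 0 < c &
     forall i x u, Y i (x, u) -> ((c * enorm x ^+ 2)%:E <= l (x, u) i)%E)
  (hd_lN : exists2 d : R, 0 < d &
     forall i x, Xf i x -> (lN x i <= (d * enorm x ^+ 2)%:E)%E)
  (hd_int : forall i, (interior (Xf i)) 0)
  (hd_V : locally_bounded_on_dom (Vstar f l lN A P N))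
  (hd_T : forall x i, (bellman f l A P lN x i <= lN x i)%E)
  (* (e) *)
  (he_delta : forall i, 0 < delta i)
  (he_Xf : forall i x, Xf i x -> enorm x <= delta i)
  (he_sigma : forall i, sigma_lin f P Pf L delta K i < m i)
  (* (f) *)
  (hf_l : forall i x, Xf i x ->
     (l (x, K i *m x) i
       <= (quad (Qbar Qc Rc K i
                  + (m i - sigma_lin f P Pf L delta K i)%:M) x)%:E)%E)
  (* (g) *)
  (hg : uniformly_invariant f Y P (fun x i => K i *m x) Xf)
  (* MPC control law *)
  (hkappa : forall i x, dom (Vstar f l lN A P N) i x ->
     Ustar f l lN A P N x i (kappaN x i)) :
  forall X : 'I_n -> set 'cV[R]_nx,
    (forall i, compact (X i)) ->
    (forall i, X i `<=` dom (Vstar f l lN A P N) i) ->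
    uniformly_invariant f Y P kappaN X ->
    RSES f Y A P kappaN X.
Proof.
move=> X Xc XV Xinv.
(* A positive horizon [k.+1] makes [V_N] a Bellman image, so it inherits the stage cost's lower
   bound. *)
case: N hN hd_V hkappa XV => // k _ Vb hkappaN XV.
have [[l0 _] [lN0 _]] := (hl, hlN).
have [c c0 l_ge] := hd_l; have [d _ lN_le] := hd_lN.
have [M M0 VM] := Vb X Xc XV.
have [D V_le] := @quadratic_upper_bound _ _ _ _ _ _ X d M
  (Vstar_le_terminal hA hP hd_T k.+1) hd_int lN_le M0 VM.
(* Off [Y i] the stage cost is nonnegative and not finite, hence [+oo], so the bound extends to all
   inputs. *)
have l_ge' x u i : ((c * enorm x ^+ 2)%:E <= l (x, u) i)%E.
  have [|nfin] := boolP (l (x, u) i \is a fin_num).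
    move=> lfin; apply: l_ge; rewrite -hldom; exact: lfin.
  by move: (l0 (x, u) i) nfin; case: (l (x, u) i) => [//|_ _|//]; rewrite leey.
apply: (@lyapunov_RSES _ _ _ _ _ _ _ _ hA hP _ _ (Vstar f l lN A P k.+1) c D)
  => // [x i|i x Xx].
  exact: (Vstar_ge_stage f hA hP l0 lN0
    (g := fun y => (c * enorm y ^+ 2)%:E)).
apply: le_trans (Vstar_lyapunov hA hP hd_T (hkappaN i x (XV i x Xx))).
by apply: leeD2r; exact: l_ge'.
Qed.
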